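(* Let $\mathcal{H}$ be a real Hilbert space, let $X\subset\mathcal{H}$ be a subset that is locally compact in the induced topology, and let $\sigma>0$. The Gaussian kernel $G_{\sigma}:X\times X\to\mathbb{R}$, $G_{\sigma}(x,y)=e^{-\sigma\|x-y\|^{2}}$, is $C_{0}(X)$-universal if and only if $\mathcal{H}_{G_{\sigma}}\subset C_{0}(X)$, where $\mathcal{H}_{G_{\sigma}}$ is the reproducing kernel Hilbert space of the kernel $G_{\sigma}$ on $X$.
   Context: A kernel $K:X\times X\to\mathbb{C}$ is positive definite if $\sum_{\mu,\nu=1}^{n}c_{\mu}\overline{c_{\nu}}K(x_{\mu},x_{\nu})\ge 0$ for all finitely many distinct points $x_{1},\dots,x_{n}\in X$ and scalars $c_{\mu}\in\mathbb{C}$. Its reproducing kernel Hilbert space $\mathcal{H}_{K}$ is the Hilbert space of functions $F:X\to\mathbb{C}$ that contains $K_{y}:=K(\cdot,y)$ for every $y\in X$, satisfies $\langle F,K_{y}\rangle_{\mathcal{H}_{K}}=F(y)$, and in which $\mathrm{span}\{K_{y}:y\in X\}$ is dense. For a locally compact Hausdorff space $X$, $C_{0}(X)$ is the Banach space (sup norm) of continuous $f:X\to\mathbb{C}$ such that for every $\epsilon>0$ there is a compact set outside of which $|f|<\epsilon$. A positive definite kernel $K$ on such $X$ is $C_{0}$-universal (also written $C_{0}(X)$-universal) if $\mathcal{H}_{K}\subset C_{0}(X)$ and for every $g\in C_{0}(X)$ and $\epsilon>0$ there is $f\in\mathcal{H}_{K}$ with $\sup_{x\in X}|f(x)-g(x)|<\epsilon$.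 *)

(* Defs.v *)
From HB Require Import structures.
From mathcomp Require Import all_boot all_order all_algebra.
From mathcomp Require Import all_classical all_reals all_analysis.
From mathcomp Require Import complex.

Set Implicit Arguments.
Unset Strict Implicit.
Unset Printing Implicit Defensive.

Import Order.TTheory GRing.Theory Num.Theory numFieldNormedType.Exports.

Local Open Scope classical_set_scope.
Local Open Scope ring_scope.

(* A Hilbert space over K is a completeNormedModType K whose norm comes from a
   dot product: theta is idfun over the reals and conjugation over R[i]. Dot
   products are linear in the first argument, theta-linear in the second. *)
Definition norm_of_dot (K : numFieldType) (V : normedModType K)
    (theta : K -> K) (dot : {dot V for theta}) : Prop :=
  forall v : V, dot v v = `|v| ^+ 2.

(* The order of R[i] is partial: 0 <= z says that z is real and nonnegative. *)
Definition positive_definite (R : realType) (T : Type) (K : T -> T -> R[i]) :=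
  forall (n : nat) (x : 'I_n -> T) (c : 'I_n -> R[i]), injective x ->
    0 <= \sum_(mu < n) \sum_(nu < n) c mu * (c nu)^* * K (x mu) (x nu).

(* The functions of the space are represented by the elements of a complex
   Hilbert space, through an injective linear evaluation map into T -> R[i]. *)
Record rkhs (R : realType) (T : Type) (K : T -> T -> R[i]) := RKHS {
  rkhs_space :> completeNormedModType R[i] ;
  rkhs_dot : {dot rkhs_space for Num.conj} ;
  rkhs_norm : norm_of_dot rkhs_dot ;
  rkhs_eval : {linear rkhs_space -> (T -> R[i])} ;
  rkhs_eval_inj : injective rkhs_eval ;
  rkhs_section : T -> rkhs_space ;
  rkhs_sectionE : forall x y : T, rkhs_eval (rkhs_section y) x = K x y ;
  rkhs_reproducing : forall (f : rkhs_space) (y : T),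
    rkhs_dot f (rkhs_section y) = rkhs_eval f y ;
  rkhs_dense : dense [set f : rkhs_space |
    exists (n : nat) (c : 'I_n -> R[i]) (y : 'I_n -> T),
      f = \sum_(i < n) c i *: rkhs_section (y i)] }.

Definition rkhs_functions (R : realType) (T : Type) (K : T -> T -> R[i])
  (HK : rkhs K) : set (T -> R[i]) := range (rkhs_eval HK).

Definition C0 (R : realType) (T : topologicalType) : set (T -> R[i]) :=
  [set f | continuous (f : T -> R[i]^o) /\
    forall eps : R, 0 < eps -> exists2 A : set T, compact A &
      forall x, ~ A x -> complex.Re `|f x| < eps].
Arguments C0 : clear implicits.

(* The supremum is taken in \bar R, so that it is +oo when f - g is unbounded. *)
Definition sup_dist (R : realType) (T : Type) (f g : T -> R[i]) : \bar R :=
  ereal_sup (range (fun x : T => (complex.Re `|f x - g x|)%:E)).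

(* A positive definite kernel has exactly one reproducing kernel Hilbert space,
   up to isometry over T -> R[i], so that quantifying over HK existentially or
   universally is the same. *)
Definition C0_universal (R : realType) (T : topologicalType)
    (K : T -> T -> R[i]) : Prop :=
  positive_definite K /\
  exists HK : rkhs K,
    rkhs_functions HK `<=` C0 R T /\
    forall (g : T -> R[i]) (eps : R), C0 R T g -> 0 < eps ->
      exists2 f, rkhs_functions HK f & (sup_dist f g < eps%:E)%E.

Definition gaussian (R : realType) (H : normedModType R) (X : set H)
    (sigma : R) (x y : X) : R :=
  expR (- sigma * `|set_val x - set_val y| ^+ 2).

Definition gaussian_kernel (R : realType) (H : normedModType R) (X : set H)
    (sigma : R) (x y : X) : R[i] :=
  (gaussian sigma x y)%:C%C.
Arguments gaussian_kernel {R H} X sigma x y.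

(* Main.v *)
(* Only the density direction needs an argument. Fix y0 in X and let
   w = G(., y0), tau x = sqrt(2 sigma) (x - y0), so that
   G(x, y) = w x * w y * e^<tau x, tau y>.
   (1) F lies in the uniform closure of span {G(., y)} as soon as the energy
   |u|^2 - 2 F(u) is bounded below on formal combinations u of points, since
   almost minimisers u are uniformly close to F. This replaces the Riesz
   representation theorem.
   (2) For F = w * cos <tau ., a> and F = w * sin <tau ., a> the energy is at
   least - e^(|a|^2): expand in power series and use that <x, y>^n is a
   positive definite kernel.
   (3) Hence the closure contains w * p for every trigonometric polynomial p in
   tau. By a Stone-Weierstrass theorem that also bounds the approximant off the
   compact set, and because w vanishes at infinity, the functions w * p are
   uniformly dense in C_0(X). *)

Require Import Defs.
From mathcomp Require Import all_boot all_order all_algebra.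
From mathcomp Require Import all_classical all_reals all_analysis.
From mathcomp Require Import complex.
From mathcomp Require Import ring lra.

Set Implicit Arguments.
Unset Strict Implicit.
Unset Printing Implicit Defensive.

Import Order.TTheory GRing.Theory Num.Theory numFieldNormedType.Exports.

Local Open Scope classical_set_scope.
Local Open Scope ring_scope.

(** * Stone-Weierstrass approximation with a global bound *)

(** If [P L] fails, the sets [B] with [P (L \ B)] form a proper filter containing [L]. It clusters
    at some [x] in [L], but the complement of a neighbourhood [U] of [x] with [P U] also belongs to
    it. *)
Lemma compact_subset_ind (T : topologicalType) (L : set T)
    (P : set T -> Prop) : compact L -> P set0 ->
  (forall U V, U `<=` V -> P V -> P U) ->
  (forall U V, P U -> P V -> P (U `|` V)) ->
  (forall x, L x -> exists2 U, nbhs x U & P U) -> P L.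
Proof.
move=> cL P0 Psub PU Ploc; apply: contrapT => nPL.
pose F : set_system T := [set B | P (L `\` B)].
have FF : ProperFilter F.
  apply: Build_ProperFilter_ex => [B FB|]; last first.
    split.
    - by rewrite /F /= setDT.
    - by move=> B C FB FC; rewrite /F /= setDIr; apply: PU.
    - by move=> B C BC; apply: Psub => x [Lx nCx]; split=> // /BC.
  apply: contrapT => /forallNP nB; apply: nPL.
  by apply: Psub FB => x Lx; split; last exact: nB.
have FL : F L by rewrite /F /= setDv.
have [x [Lx clx]] := cL F FF FL.
have [U xU PUU] := Ploc x Lx.
have FnU : F (~` U) by apply: Psub PUU => y [_] /contrapT.
by have [y [nUy Uy]] := clx _ _ FnU xU.
Qed.

Definition uniform_closure (R : realType) (T : Type) (A : set (T -> R)) :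
    set (T -> R) :=
  [set f | forall eps : R, 0 < eps ->
    exists2 g, A g & forall x, `|f x - g x| <= eps].

Section UniformClosure.
Variables (R : realType) (T : Type) (A : set (T -> R)).

Lemma sub_uniform_closure : A `<=` uniform_closure A.
Proof. by move=> f Af e e0; exists f => // x; rewrite subrr normr0 ltW. Qed.

Lemma uniform_closure_idem :
  uniform_closure (uniform_closure A) `<=` uniform_closure A.
Proof.
move=> f Af e e0; have e20 : 0 < e / 2 by rewrite divr_gt0.
have [g Ag fg] := Af _ e20; have [h Ah gh] := Ag _ e20; exists h => // x.
rewrite (splitr e) -(subrKA (g x)) (le_trans (ler_normD _ _))//.
exact: lerD.
Qed.

Hypothesis AD : forall f g, A f -> A g -> A (fun x => f x + g x).
Hypothesis AZ : forall c f, A f -> A (fun x => c * f x).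

Lemma uniform_closureD f g : uniform_closure A f -> uniform_closure A g ->
  uniform_closure A (fun x => f x + g x).
Proof.
move=> Af Ag e e0; have e20 : 0 < e / 2 by rewrite divr_gt0.
have [f' Af' ff'] := Af _ e20; have [g' Ag' gg'] := Ag _ e20.
exists (fun x => f' x + g' x); first exact: AD.
move=> x; rewrite (splitr e) opprD addrACA (le_trans (ler_normD _ _))//.
exact: lerD.
Qed.

Lemma uniform_closureZ c f : uniform_closure A f ->
  uniform_closure A (fun x => c * f x).
Proof.
move=> Af e e0; have d0 : 0 < e / (`|c| + 1) by rewrite divr_gt0 ?ltr_wpDl.
have [f' Af' ff'] := Af _ d0; exists (fun x => c * f' x); first exact: AZ.
move=> x; rewrite -mulrBr normrM.
have := ff' x; rewrite ler_pdivlMr ?ltr_wpDl// => /(le_trans _); apply.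
by rewrite mulrC ler_wpM2l// lerDl.
Qed.

End UniformClosure.

Section StoneWeierstrass.
Variables (R : realType) (T : topologicalType) (A : set (T -> R)).
Hypothesis A_cst : forall c, A (fun=> c).
Hypothesis AD : forall f g, A f -> A g -> A (fun x => f x + g x).
Hypothesis AM : forall f g, A f -> A g -> A (fun x => f x * g x).
Hypothesis A_bounded : forall f, A f -> exists M, forall x, `|f x| <= M.
Hypothesis A_continuous : forall f, A f -> continuous f.
Hypothesis A_interpolates : forall x y a b, x <> y ->
  exists2 f, A f & f x = a /\ f y = b.

Let AZ c f (Af : A f) : A (fun x => c * f x).
Proof. exact: AM (A_cst c) Af. Qed.

(* The iteration p <- p + (s^2 - p^2) / 2 increases from 0 to s, uniformly for
   0 <= s <= 1, and involves s only through its square. *)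
Lemma abs_uniform_closure_unit f : A f -> (forall x, `|f x| <= 1) ->
  uniform_closure A (fun x => `|f x|).
Proof.
move=> Af f1.
pose p := fix p n : T -> R := if n is n'.+1 then
  fun x => p n' x + 2^-1 * (f x * f x + (- 1) * (p n' x * p n' x)) else fun=> 0.
have Ap n : A (p n).
  elim: n => [|n IH]; first exact: A_cst.
  by apply: AD => //; apply: AZ; apply: AD; [exact: AM|apply: AZ; exact: AM].
(* The error e at rank n becomes e (1 - (s + p) / 2) <= e (1 - e / 2), because p >= 0. As t (1 - t /
   2) increases on [0, 1], the bound 2 / (n + 2) propagates; at n = 0 it is the bound 1 on
   [|f x|]. *)
have pP n x : 0 <= `|f x| - p n x <= 2 / n.+2%:R /\ 0 <= p n x.
  elim: n => [|n [/andP[e0 e1] p0]] /=.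
    by rewrite subr0 divff ?normr_ge0 ?f1.
  have s0 := normr_ge0 (f x); have s1 := f1 x.
  have ffE : f x * f x = `|f x| * `|f x|.
    by rewrite -normrM ger0_norm// -expr2 sqr_ge0.
  rewrite ffE; set s := `|f x| in s0 s1 e0 e1 *; set q := p n x in e0 e1 p0 *.
  have qs : q <= s by lra.
  split; last by nra.
  apply/andP; split; first by nra.
  have N0 : 0 < n.+2%:R :> R by [].
  rewrite [n.+3%:R]mulrSr; set N : R := n.+2%:R in N0 e1 *.
  have N2 : 2 <= N by rewrite /N ler_nat.
  set y := 2 / N in e1.
  have yN : y * N = 2 by rewrite /y divfK// gt_eqF.
  have y1 : y <= 1 by rewrite /y ler_pdivrMr// mul1r.
  have y0 : 0 <= y by rewrite /y divr_ge0// ltW.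
  have N1 : 0 < N + 1 by lra.
  rewrite ler_pdivlMr//.
  set e := s - q in e0 e1.
  have -> : s - (q + 2^-1 * (s * s + -1 * (q * q))) = e * (1 - (s + q) / 2).
    by rewrite /e; field.
  have h1 : e * (1 - (s + q) / 2) <= e * (1 - e / 2).
    by apply: ler_wpM2l => //; rewrite /e; lra.
  have h2 : e * (1 - e / 2) <= y * (1 - y / 2) by nra.
  (* With y = 2 / N the left side equals 2 (1 - 1 / N^2). *)
  have h3 : y * (1 - y / 2) * (N + 1) <= 2 by nra.
  by apply: le_trans h3; apply: ler_wpM2r; [exact: ltW|exact: le_trans h1 h2].
move=> e e0; exists (p (Num.truncn (2 / e))); first exact: Ap.
move=> x; have [/andP[h0 h1] _] := pP (Num.truncn (2 / e)) x.
rewrite ger0_norm//; apply: le_trans h1 _.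
rewrite ler_pdivrMr// -ler_pdivrMl// mulrC.
apply: ltW; apply: lt_trans (truncnS_gt _) _.
by rewrite ltr_nat.
Qed.

Lemma abs_uniform_closure f : uniform_closure A f ->
  uniform_closure A (fun x => `|f x|).
Proof.
move=> Af; apply: uniform_closure_idem => e e0.
have [g Ag fg] := Af e e0; exists (fun x => `|g x|); last first.
  by move=> x; apply: le_trans (fg x); exact: ler_dist_dist.
have [M gM] := A_bounded Ag; pose M' := `|M| + 1.
have M'0 : 0 < M' by rewrite ltr_wpDl.
have -> : (fun x => `|g x|) = (fun x => M' * `|M'^-1 * g x|).
  apply/funext => x; rewrite normrM gtr0_norm ?invr_gt0// mulrA divff ?mul1r//.
  by rewrite gt_eqF.
apply: uniform_closureZ => //; apply: abs_uniform_closure_unit; first exact: AZ.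
move=> x; rewrite normrM gtr0_norm ?invr_gt0// mulrC ler_pdivrMr// mul1r.
by rewrite (le_trans (gM x))// /M' (le_trans (ler_norm M))// lerDl.
Qed.

Lemma max_uniform_closure f g : uniform_closure A f -> uniform_closure A g ->
  uniform_closure A (fun x => Num.max (f x) (g x)).
Proof.
move=> Af Ag.
have -> : (fun x => Num.max (f x) (g x)) =
    (fun x => 2^-1 * (f x + g x + `|f x + (- 1) * g x|)).
  by apply/funext => x; rewrite mulN1r maxr_absE mulrC.
apply: uniform_closureZ => //; apply: uniform_closureD => //.
  exact: uniform_closureD.
apply: abs_uniform_closure; apply: uniform_closureD => //.
exact: uniform_closureZ.
Qed.

Lemma min_uniform_closure f g : uniform_closure A f -> uniform_closure A g ->
  uniform_closure A (fun x => Num.min (f x) (g x)).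
Proof.
move=> Af Ag.
have -> : (fun x => Num.min (f x) (g x)) =
    (fun x => -1 * Num.max (-1 * f x) (-1 * g x)).
  by apply/funext => x; rewrite !mulN1r -oppr_min opprK.
apply: uniform_closureZ => //.
by apply: max_uniform_closure; exact: uniform_closureZ.
Qed.

(** Continuity is carried along because the compactness arguments below use neighbourhoods defined
    by strict inequalities between such functions. *)
Let closed_cont f := uniform_closure A f /\ continuous f.

Let closed_cont_cst c : closed_cont (fun=> c).
Proof. by split; [exact/sub_uniform_closure/A_cst|exact: cst_continuous]. Qed.

Let closed_cont_max f g : closed_cont f -> closed_cont g ->
  closed_cont (fun x => Num.max (f x) (g x)).
Proof.
move=> [Af cf] [Ag cg]; split; first exact: max_uniform_closure.
by move=> x; apply: continuous_max; [exact: cf|exact: cg].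
Qed.

Let closed_cont_min f g : closed_cont f -> closed_cont g ->
  closed_cont (fun x => Num.min (f x) (g x)).
Proof.
move=> [Af cf] [Ag cg]; split; first exact: min_uniform_closure.
by move=> x; apply: continuous_min; [exact: cf|exact: cg].
Qed.

Lemma stone_weierstrass_bounded (L : set T) (h : T -> R) (B eps : R) :
  compact L -> continuous h -> (forall x, `|h x| <= B) -> 0 < eps ->
  exists p, [/\ A p, forall x, L x -> `|p x - h x| <= eps &
    forall x, `|p x| <= B + eps].
Proof.
move=> cL ch hB eps0; pose d := eps / 2.
have d0 : 0 < d by rewrite divr_gt0.
have epsE : eps = d + d by rewrite /d -splitr.
move: d d0 epsE => d d0 epsE.
have nbhs_lt (f g : T -> R) (x : T) : continuous f -> continuous g ->
    f x < g x -> nbhs x [set z | f z < g z].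
  move=> cf cg fgx; have : \forall z \near x, 0 < g z - f z.
    have /cvgr_gt : (fun z => g z - f z) @ x --> g x - f x.
      by apply: cvgB; [exact: cg|exact: cf].
    by apply; rewrite subr_gt0.
  by apply: filterS => z /=; rewrite subr_gt0.
have hD c : continuous (fun z => h z + c).
  by move=> z; apply: cvgD; [exact: ch|exact: cvg_cst].
(* First compactness argument: finite minima of functions exact at [x] and at a second point stay
   exact at [x] and below [h + d] on [L]. *)
have above x : exists f, [/\ closed_cont f, f x = h x &
    forall z, L z -> f z < h z + d].
  pose P U := exists f, [/\ closed_cont f, f x = h x &
    forall z, U z -> f z < h z + d].
  apply: (@compact_subset_ind _ L P) => //.
  - by exists (fun=> h x); split => //; exact: closed_cont_cst.
  - by move=> U V UV [f [cf fx fV]]; exists f; split => // z /UV; exact: fV.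
  - move=> U V [f [cf fx fU]] [g [cg gx gV]].
    exists (fun z => Num.min (f z) (g z)); split.
    + exact: closed_cont_min.
    + by rewrite fx gx minxx.
    + by move=> z [/fU|/gV] H; rewrite gt_min H ?orbT.
  - move=> y Ly; have [f [cf fx fy]] : exists f, [/\ closed_cont f, f x = h x &
        f y = h y].
      have [->|/eqP xy] := eqVneq x y.
        by exists (fun=> h y); split => //; exact: closed_cont_cst.
      have [f Af [fx fy]] := A_interpolates (h x) (h y) xy.
      exists f; split => //; split; first exact: sub_uniform_closure.
      exact: A_continuous.
    exists [set z | f z < h z + d].
      by apply: nbhs_lt => //; [exact: cf.2|rewrite fy ltrDl].
    by exists f.
(* Second compactness argument: finite maxima of the previous functions keep the upper bound and
   gain the lower one. The constant [- B] serves for the empty set. *)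
have [f [[Af cf] fub flb]] : exists f, [/\ closed_cont f,
    forall z, L z -> f z < h z + d & forall z, L z -> h z + (- d) < f z].
  pose P U := exists f, [/\ closed_cont f,
    forall z, L z -> f z < h z + d & forall z, U z -> h z + (- d) < f z].
  apply: (@compact_subset_ind _ L P) => //.
  - exists (fun=> - B); split => // z _.
    by have := hB z; rewrite ler_norml => /andP[+ _]; lra.
  - by move=> U V UV [f [cf fx fV]]; exists f; split => // z /UV; exact: fV.
  - move=> U V [f [cf fx fU]] [g [cg gx gV]].
    exists (fun z => Num.max (f z) (g z)); split.
    + exact: closed_cont_max.
    + by move=> z Lz; rewrite gt_max fx// gx.
    + by move=> z [/fU|/gV] H; rewrite lt_max H ?orbT.
  - move=> x Lx; have [f [cf fx fL]] := above x.
    exists [set z | h z + (- d) < f z].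
      by apply: nbhs_lt => //; [exact: cf.2|rewrite fx; lra].
    by exists f.
(* Clamping to [[- B, B]] keeps [f] within [d] of [h] on [L], since [h] takes its values there, and
   supplies the bound off [L]. The other [d] pays for the passage from the closure to [A]. *)
have [p Ap fp] : exists2 p, A p &
    forall x, `|Num.max (- B) (Num.min B (f x)) - p x| <= d.
  apply: (max_uniform_closure (f := fun=> - B)) => //.
    exact/sub_uniform_closure/A_cst.
  apply: (min_uniform_closure (f := fun=> B)) => //.
  exact/sub_uniform_closure/A_cst.
exists p; split => // x.
  move=> Lx; have f1 := flb x Lx; have f2 := fub x Lx.
  have /andP[h1 h2] : - B <= h x <= B by rewrite -ler_norml.
  have := fp x; rewrite !ler_norml.
  by case: (leP B (f x)) => fB; [case: (leP (- B) B)|case: (leP (- B) (f x))] =>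
    fNB /andP[p1 p2]; apply/andP; split; lra.
have /andP[h1 h2] : - B <= h x <= B by rewrite -ler_norml.
have := fp x; rewrite !ler_norml.
by case: (leP B (f x)) => fB; [case: (leP (- B) B)|case: (leP (- B) (f x))] =>
  fNB /andP[p1 p2]; apply/andP; split; lra.
Qed.

End StoneWeierstrass.

(** * Weighted approximation of functions vanishing at infinity *)

Section WeightedApproximation.
Variables (R : realType) (T : topologicalType).

Definition vanishes_at_infinity (g : T -> R) :=
  forall eps : R, 0 < eps -> exists2 L : set T, compact L &
    forall x, ~ L x -> `|g x| < eps.

Variable A : set (T -> R).
Hypothesis A_cst : forall c, A (fun=> c).
Hypothesis AD : forall f g, A f -> A g -> A (fun x => f x + g x).
Hypothesis AM : forall f g, A f -> A g -> A (fun x => f x * g x).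
Hypothesis A_bounded : forall f, A f -> exists M, forall x, `|f x| <= M.
Hypothesis A_continuous : forall f, A f -> continuous f.
Hypothesis A_interpolates : forall x y a b, x <> y ->
  exists2 f, A f & f x = a /\ f y = b.

Lemma weighted_stone_weierstrass (w g : T -> R) :
  continuous w -> (forall x, 0 < w x <= 1) -> vanishes_at_infinity w ->
  continuous g -> vanishes_at_infinity g ->
  uniform_closure [set (fun x => w x * p x) | p in A] g.
Proof.
move=> cw w01 w_oo cg g_oo e e0; pose d := e / 2.
have d0 : 0 < d by rewrite divr_gt0.
have w0 x : w x != 0 by have /andP[? _] := w01 x; rewrite gt_eqF.
pose h x := g x / w x.
have ch : continuous h.
  by move=> x; apply: cvgM; [exact: cg|apply: cvgV => //; exact: cw].
have gE x : g x = w x * h x by rewrite /h mulrC divfK.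
have [L1 cL1 gL1] := g_oo d d0.
have [B B0 hB] : exists2 B : R, 0 < B & forall x, L1 x -> `|h x| <= B.
  have : compact (h @` L1).
    by apply: continuous_compact => //; exact: continuous_subspaceT.
  move=> /compact_bounded[M [_ /(_ (`|M| + 1)) hM]].
  exists (`|M| + 1); first by rewrite ltr_wpDl.
  move=> x L1x; apply: hM; last by exists x.
  by rewrite (le_lt_trans (ler_norm M))// ltrDl.
(* The quotient [h] may be unbounded off [L1]. Its truncation agrees with it on [L1]; elsewhere
   [|h - t| <= |h|], so that [w * t] differs from [g] by at most [|g|], which is small there. *)
pose t x := Num.max (- B) (Num.min B (h x)).
have ct : continuous (fun x => Num.max (- B) (Num.min B (h x))).
  have cc c : continuous (fun _ : T => c : R) by move=> x; exact: cvg_cst.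
  move=> x; apply: (continuous_max (cc (- B) x)).
  exact: (continuous_min (cc B x) (ch x)).
have tB x : `|t x| <= B.
  rewrite ler_norml /t; apply/andP.
  by case: (leP B (h x)) => hx; [case: (leP (- B) B)|case: (leP (- B) (h x))];
    split; lra.
have th x : `|h x| <= B -> t x = h x.
  rewrite ler_norml /t => /andP[h1 h2].
  by rewrite (min_idPr h2) (max_idPr h1).
have ht x : `|h x - t x| <= `|h x|.
  have [hx|hx] := leP `|h x| B; first by rewrite th// subrr normr0.
  rewrite /t; case: (leP B (h x)) => h1.
    rewrite (max_idPr _); last lra.
    by rewrite !ger0_norm; lra.
  have h2 : h x <= - B.
    by move: hx; rewrite ltNge ler_norml (ltW h1) andbT -ltNge => /ltW.
  rewrite (max_idPl _)//.
  by rewrite !ler0_norm; lra.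
have Bd0 : 0 < B + d by lra.
(* The threshold is chosen against the global bound [B + d] on [p]: off [L2], [|w * p| <= d]. *)
have [L2 cL2 wL2] := w_oo (d / (B + d)) (divr_gt0 d0 Bd0).
have [p [Ap pL pB]] := stone_weierstrass_bounded A_cst AD AM A_bounded
  A_continuous A_interpolates (compactU cL1 cL2) ct tB d0.
exists (fun x => w x * p x); first by exists p.
move=> x; have /andP[w0x w1x] := w01 x.
have wtg : `|g x - w x * t x| <= d.
  have [L1x|nL1x] := pselect (L1 x).
    by rewrite gE (th _ (hB x L1x)) subrr normr0 ltW.
  rewrite gE -mulrBr normrM; apply: le_trans (ltW (gL1 x nL1x)).
  by rewrite [in leRHS]gE normrM ler_wpM2l.
have [Lx|nLx] := pselect ((L1 `|` L2) x).
  rewrite -(subrKA (w x * t x)) (le_trans (ler_normD _ _))//.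
  rewrite [leRHS]splitr lerD// -mulrBr normrM distrC (le_trans _ (pL x Lx))//.
  by rewrite ler_piMl// gtr0_norm.
rewrite (le_trans (ler_normB _ _))// [leRHS]splitr lerD//.
  by apply/ltW/gL1 => ?; apply: nLx; left.
have nL2x : ~ L2 x by move=> ?; apply: nLx; right.
rewrite normrM; apply: (@le_trans _ _ (d / (B + d) * (B + d))).
  by apply: ler_pM => //; exact/ltW/wL2.
by rewrite divfK ?gt_eqF.
Qed.
End WeightedApproximation.

(** * Real positive definite kernels *)

Section QuadraticForm.
Variables (R : realType) (T : Type).
Implicit Types (K : T -> T -> R) (s : seq (R * T)).

(** Formal combinations are lists in which points may repeat, so that a point can be added, or all
    points mapped, without merging coefficients. *)
Definition kernel_comb K s : T -> R := fun x => \sum_(p <- s) p.1 * K x p.2.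

Definition kernel_form K s : R :=
  \sum_(p <- s) \sum_(q <- s) p.1 * q.1 * K p.2 q.2.

Definition real_positive_definite K := forall s, 0 <= kernel_form K s.

Lemma kernel_form_cons K p s : (forall x y, K x y = K y x) ->
  kernel_form K (p :: s) =
  p.1 ^+ 2 * K p.2 p.2 + 2 * p.1 * kernel_comb K s p.2 + kernel_form K s.
Proof.
move=> Ksym; rewrite /kernel_form /kernel_comb big_cons big_cons -expr2 -!addrA.
congr (_ + _); under [X in _ + X]eq_bigr do rewrite big_cons.
rewrite big_split /= addrA; congr (_ + _); rewrite -big_split /= mulr_sumr.
by apply: eq_bigr => q _; rewrite (Ksym q.2); ring.
Qed.

(* At a near-minimiser s of kernel_form s - 2 * \sum p.1 * F p.2, perturbing s
   by the single point x shows that kernel_comb K s x is close to F x. *)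
Lemma uniform_closure_kernel_comb K (F : T -> R) (C : R) :
  (forall x y, K x y = K y x) -> (forall x, K x x = 1) ->
  (forall s, - C <= kernel_form K s - 2 * \sum_(p <- s) p.1 * F p.2) ->
  uniform_closure (range (kernel_comb K)) F.
Proof.
move=> Ksym K1 bnd e e0.
pose J s := kernel_form K s - 2 * \sum_(p <- s) p.1 * F p.2.
have lbJ : has_lbound (range J) by exists (- C) => _ [s _ <-]; exact: bnd.
have infJ : has_inf (range J) by split => //; exists (J [::]), [::].
have [_ [s _ <-] sJ] := inf_adherent (exprn_gt0 2 e0) infJ.
exists (kernel_comb K s) => [|x]; first by exists s.
(* This coefficient at [x] is the optimal one and lowers the energy by exactly [d ^+ 2]. Since [s]
   is within [e ^+ 2] of the infimum, [|d| <= e]. *)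
pose d := F x - kernel_comb K s x.
have : inf (range J) <= J ((d, x) :: s).
  by apply: ge_inf => //; exists ((d, x) :: s).
have -> : J ((d, x) :: s) = J s - d ^+ 2.
  by rewrite /J kernel_form_cons// big_cons /= K1 /d; ring.
rewrite -/d; move: sJ; set a := inf _ => sJ h.
rewrite -(@ler_pXn2r _ 2) ?nnegrE ?normr_ge0 ?(ltW e0)//.
by rewrite real_normK ?num_real//; lra.
Qed.

End QuadraticForm.

(** * Products of kernels with a dot product *)

Section SchurProduct.
Variables (R : realType) (H : lmodType R) (dot : {dot H for idfun}).

Lemma dot_sym u v : dot u v = dot v u.
Proof. by rewrite hermC expr0 mul1r. Qed.

(* Orthogonally projecting every vector off one of them splits the Gram matrix
   into a rank one part and the Gram matrix of fewer nonzero vectors. *)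
Lemma real_positive_definite_mul_dot (T : eqType) (K : T -> T -> R)
    (v : T -> H) :
  real_positive_definite K ->
  real_positive_definite (fun x y => K x y * dot (v x) (v y)).
Proof.
move=> pdK s; have [n] := ubnP (count (fun p => v p.2 != 0) s).
elim: n => // n IH in v *; rewrite ltnS => sn.
have [/hasP|] := boolP (has (fun p => v p.2 != 0) s); last first.
  rewrite -all_predC => /allP v0; rewrite /kernel_form big_seq big1// => p ps.
  have /negPn/eqP-> := v0 p ps.
  by rewrite big1// => q _; rewrite linear0l !mulr0.
move=> [p0 p0s v0]; pose N := dot (v p0.2) (v p0.2).
have N0 : 0 < N by exact: neq0_dnorm_gt0.
pose v' x := v x - (dot (v x) (v p0.2) / N) *: v p0.2.
have vE x y : dot (v x) (v y) =
    dot (v x) (v p0.2) * dot (v y) (v p0.2) / N + dot (v' x) (v' y).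
  rewrite /v' linearBl/= !linearBr/= !linearZl_LR/= !linearZr_LR/=.
  by rewrite -/N (dot_sym (v p0.2)) /GRing.scale /=; field; rewrite gt_eqF.
(* The rank one factor is absorbed into the coefficients, which leaves a form of [K] alone. *)
have -> : kernel_form (fun x y => K x y * dot (v x) (v y)) s =
    N^-1 * kernel_form K [seq (p.1 * dot (v p.2) (v p0.2), p.2) | p <- s] +
    kernel_form (fun x y => K x y * dot (v' x) (v' y)) s.
  rewrite /kernel_form big_map mulr_sumr -big_split/=; apply: eq_bigr => p _.
  rewrite big_map mulr_sumr -big_split/=; apply: eq_bigr => q _.
  by rewrite vE; ring.
apply: addr_ge0; first by apply: mulr_ge0; [rewrite invr_ge0 ltW|exact: pdK].
apply: IH; apply: leq_trans sn.
have v'0 : v' p0.2 = 0 by rewrite /v' -/N divff ?gt_eqF// scale1r subrr.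
have sub x : v x = 0 -> v' x = 0.
  by move=> vx; rewrite /v' vx linear0l mul0r scale0r subrr.
rewrite -[ltnRHS]size_filter -(count_predC (fun p => v' p.2 != 0)).
rewrite count_filter -addn1 leq_add//.
  rewrite sub_count// => p /= v'p; rewrite v'p /=.
  by apply: contra_neq v'p => /sub.
rewrite -has_count; apply/hasP; exists p0; first by rewrite mem_filter v0.
by rewrite /= v'0 eqxx.
Qed.

Lemma real_positive_definite_exp_dot n :
  real_positive_definite (fun x y => dot x y ^+ n).
Proof.
elim: n => [|n IH].
  move=> s; rewrite /kernel_form.
  have -> : \sum_(p <- s) \sum_(q <- s) p.1 * q.1 * dot p.2 q.2 ^+ 0 =
      (\sum_(p <- s) p.1) ^+ 2.
    rewrite expr2 mulr_suml; apply: eq_bigr => p _; rewrite mulr_sumr.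
    by apply: eq_bigr => q _; rewrite mulr1.
  exact: sqr_ge0.
under [X in real_positive_definite X]eq_fun do under eq_fun do rewrite exprSr.
exact: real_positive_definite_mul_dot.
Qed.
End SchurProduct.

(** * Energy bounds for the exponential kernel *)

Section ExponentialKernel.
Variables (R : realType) (H : lmodType R) (dot : {dot H for idfun}).

(* Term by term: n! times the difference of the n-th terms is at least the form
   of (dot x y)^n at s extended by the vector a with coefficient - c n. *)
Lemma exp_dot_form_bound (c : nat -> R) (phi : R -> R) (a : H)
    (s : seq (R * H)) :
  (forall n, c n ^+ 2 <= 1) ->
  (forall t, series (fun n => c n * (t ^+ n / n`!%:R)) @ \oo --> phi t) ->
  - expR (dot a a) <=
    kernel_form (fun x y => expR (dot x y)) s -
    2 * \sum_(p <- s) p.1 * phi (dot p.2 a).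
Proof.
move=> c1 cphi; rewrite -subr_ge0 opprK.
(* [D N] truncates every power series at degree [N]. It is nonnegative for each [N], and the claim
   follows in the limit. *)
pose D1 N := \sum_(p <- s) \sum_(q <- s)
  p.1 * q.1 * series (exp_coeff (dot p.2 q.2)) N.
pose D2 N := \sum_(p <- s) p.1 *
  series (fun n => c n * (dot p.2 a ^+ n / n`!%:R)) N.
pose D N := D1 N - 2 * D2 N + series (exp_coeff (dot a a)) N.
have cvgexp t : series (exp_coeff t) @ \oo --> expR t.
  exact: is_cvg_series_exp_coeff.
have cvgsum (I : Type) (r : seq I) (u : I -> nat -> R) (l : I -> R) :
    (forall i, u i @ \oo --> l i) ->
    (fun N => \sum_(i <- r) u i N) @ \oo --> \sum_(i <- r) l i.
  by move=> ul; apply: cvg_big => //; exact: add_continuous.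
have cD : D @ \oo --> kernel_form (fun x y => expR (dot x y)) s -
    2 * (\sum_(p <- s) p.1 * phi (dot p.2 a)) + expR (dot a a).
  apply: (@cvgD _ _ _ _ _ (fun N => D1 N - 2 * D2 N)); last exact: cvgexp.
  apply: (@cvgB _ _ _ _ _ D1 (fun N => 2 * D2 N)).
    apply: (@cvgsum _ s (fun p N => \sum_(q <- s)
      p.1 * q.1 * series (exp_coeff (dot p.2 q.2)) N)) => p.
    apply: (@cvgsum _ s (fun q N => p.1 * q.1 * series (exp_coeff _) N)) => q.
    by apply: cvgM; [exact: cvg_cst|exact: cvgexp].
  apply: (@cvgM _ _ _ _ (fun=> 2) D2); first exact: cvg_cst.
  apply: (@cvgsum _ s (fun p N => p.1 * series _ N)) => p.
  by apply: cvgM; [exact: cvg_cst|exact: cphi].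
apply: (cvgr_to_ge cD); apply: nearW => N.
suff -> : D N = \sum_(0 <= n < N) (n`!%:R)^-1 *
    (kernel_form (fun x y => dot x y ^+ n) s -
     2 * c n * (\sum_(p <- s) p.1 * dot p.2 a ^+ n) + dot a a ^+ n).
  apply: sumr_ge0 => n _; apply: mulr_ge0; first by rewrite invr_ge0.
  have := real_positive_definite_exp_dot dot n ((- c n, a) :: s).
  rewrite kernel_form_cons => [|x y]; last by rewrite dot_sym.
  rewrite /kernel_comb /=; under eq_bigr do rewrite dot_sym.
  (* Needed to replace the coefficient [c n ^+ 2] of this term by 1. *)
  have aa0 : 0 <= dot a a ^+ n.
    apply: exprn_ge0; have [->|/neq0_dnorm_gt0/ltW//] := eqVneq a 0.
    by rewrite linear0l.
  rewrite sqrrN; have := c1 n.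
  set S := \sum_(_ <- _) _; set K := kernel_form _ _.
  set A := _ ^+ n in aa0 *; nra.
have seriesS (u : nat -> R) n : series u n.+1 = series u n + u n.
  by rewrite seriesSr.
elim: N => [|N IH].
  rewrite /D /D1 /D2 big_geq// !big1 ?mulr0 ?subr0 ?add0r/=.
  - by rewrite /series /= big_geq.
  - by move=> p _; rewrite /series/= big_geq// mulr0.
  - by move=> p _; rewrite big1// => q _; rewrite /series/= big_geq// mulr0.
rewrite big_nat_recr//= -IH /D seriesS.
have -> : D1 N.+1 = D1 N + N`!%:R^-1 * kernel_form (fun x y => dot x y ^+ N) s.
  rewrite /D1 /kernel_form mulr_sumr -big_split; apply: eq_bigr => p _ /=.
  rewrite mulr_sumr -big_split; apply: eq_bigr => q _ /=.
  by rewrite seriesS /exp_coeff/=; ring.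
have -> : D2 N.+1 =
    D2 N + N`!%:R^-1 * (c N * \sum_(p <- s) p.1 * dot p.2 a ^+ N).
  rewrite /D2 !mulr_sumr -big_split; apply: eq_bigr => p _ /=.
  by rewrite seriesS; ring.
by rewrite /exp_coeff/=; ring.
Qed.
End ExponentialKernel.

(** * The Gaussian kernel *)

Section TrigonometricPolynomials.
Variables (R : realType) (H : lmodType R) (dot : {dot H for idfun}).
Variables (T : Type) (tau : T -> H).

(** The phase [b] covers sines and cosines by one constructor, so that closure under products needs
    a single addition formula. *)
Inductive trig_poly : (T -> R) -> Prop :=
| trig_wave a b : trig_poly (fun x => cos (dot (tau x) a + b))
| trig_scale c f : trig_poly f -> trig_poly (fun x => c * f x)
| trig_add f g : trig_poly f -> trig_poly g -> trig_poly (fun x => f x + g x).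

Lemma trig_poly_cst c : trig_poly (fun=> c).
Proof.
have -> : (fun=> c) = (fun x : T => c * cos (dot (tau x) 0 + 0)).
  by apply/funext => x; rewrite linear0r addr0 cos0 mulr1.
exact/trig_scale/trig_wave.
Qed.

Lemma trig_poly_mul f g : trig_poly f -> trig_poly g ->
  trig_poly (fun x => f x * g x).
Proof.
move=> tf tg; elim: tf => {f} [a b|c f _ IH|f f' _ IH _ IH'].
- elim: tg => {g} [a' b'|c g _ IH|g g' _ IH _ IH'].
  + have -> : (fun x => cos (dot (tau x) a + b) * cos (dot (tau x) a' + b')) =
        (fun x => 2^-1 * (cos (dot (tau x) (a + a') + (b + b')) +
                          cos (dot (tau x) (a - a') + (b - b')))).
      apply/funext => x; set u := dot _ a + b; set v := dot _ a' + b'.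
      have -> : dot (tau x) (a + a') + (b + b') = u + v.
        by rewrite linearDr /= addrACA.
      have -> : dot (tau x) (a - a') + (b - b') = u - v.
        by rewrite linearBr /= opprD addrACA.
      by rewrite (cosD u v) (cosB u v); field.
    by apply: trig_scale; apply: trig_add; exact: trig_wave.
  + under eq_fun do rewrite mulrCA; exact: trig_scale.
  + under eq_fun do rewrite mulrDr; exact: trig_add.
- under eq_fun do rewrite -mulrA; exact: trig_scale.
- under eq_fun do rewrite mulrDl; exact: trig_add.
Qed.

Lemma trig_poly_bounded f : trig_poly f -> exists M, forall x, `|f x| <= M.
Proof.
elim => {f} [a b|c f _ [M fM]|f g _ [M fM] _ [N gN]].
- by exists 1 => x; rewrite ler_norml cos_geN1 cos_le1.
- by exists (`|c| * M) => x; rewrite normrM ler_wpM2l.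
- by exists (M + N) => x; rewrite (le_trans (ler_normD _ _))// lerD.
Qed.

Lemma trig_poly_interpolates : injective tau -> forall x y u v, x <> y ->
  exists2 f, trig_poly f & f x = u /\ f y = v.
Proof.
move=> tau_inj x y u v xy; pose z := tau y - tau x.
have z0 : z != 0 by rewrite subr_eq0; apply/eqP => /tau_inj/esym.
have N0 : dot z z != 0 by rewrite gt_eqF// neq0_dnorm_gt0.
(* With this frequency the wave advances by a quarter period from [x] to [y]; the phase makes its
   argument [- pi / 2] at [x] and 0 at [y]. *)
pose a := (pi / 2 / dot z z) *: z.
exists (fun s =>
    u + (v - u) * cos (dot (tau s) a + (- dot (tau x) a - pi / 2))).
  by apply: trig_add; [exact: trig_poly_cst|exact/trig_scale/trig_wave].
have cosx : cos (dot (tau x) a + (- dot (tau x) a - pi / 2)) = 0.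
  by rewrite addNKr cosN cos_pihalf.
have cosy : cos (dot (tau y) a + (- dot (tau x) a - pi / 2)) = 1.
  rewrite addrA -linearBl/= -/z /a linearZr_LR/=.
  by rewrite divfK// subrr cos0.
by rewrite cosx cosy mulr0 addr0 mulr1 addrC subrK.
Qed.
End TrigonometricPolynomials.

Section Gaussian.
Variables (R : realType) (H : normedModType R) (dot : {dot H for idfun}).
Hypothesis dot_norm : norm_of_dot dot.

Lemma continuous_dotl (a : H) : continuous (fun x => dot x a).
Proof.
have CS x : `|dot x a| <= `|x| * `|a|.
  rewrite -(@ler_pXn2r _ 2) ?nnegrE ?mulr_ge0//= exprMn -!dot_norm.
  rewrite real_normK ?num_real//.
  have [->|a0] := eqVneq a 0; first by rewrite !linear0r expr0n.
  (* Cauchy-Schwarz: the component of [x] orthogonal to [a], scaled by [dot a a] to avoid division,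
     has nonnegative square. *)
  have N0 : 0 < dot a a := neq0_dnorm_gt0 _ a0.
  have : 0 <= dot (dot a a *: x - dot x a *: a) (dot a a *: x - dot x a *: a).
    by rewrite dot_norm exprn_ge0.
  rewrite linearBl/= !linearBr/= !linearZl_LR/= !linearZr_LR/= /GRing.scale/=.
  rewrite (dot_sym _ a x); set u := dot x a; set v := dot x x.
  set N := dot a a in N0 *; move=> h.
  have : 0 <= N * (v * N - u ^+ 2) by move: h; congr (0 <= _); ring.
  by rewrite pmulr_rge0// subr_ge0.
move=> x; apply/cvgrPdist_le => e e0.
have d0 : 0 < e / (`|a| + 1) by rewrite divr_gt0// ltr_wpDl.
near=> y.
rewrite -linearBl/= (le_trans (CS _))//.
have : `|x - y| <= e / (`|a| + 1).
  by near: y; apply: cvgr_dist_le => //; exact: cvg_id.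
rewrite ler_pdivlMr ?ltr_wpDl//; apply: le_trans.
by rewrite ler_wpM2l// lerDl.
Unshelve. all: by end_near.
Qed.

Lemma normB_sqr (u v : H) :
  `|u - v| ^+ 2 = `|u| ^+ 2 + `|v| ^+ 2 - 2 * dot u v.
Proof.
by rewrite -!dot_norm linearBl/= !linearBr/= (dot_sym _ v u); ring.
Qed.

Variables (X : set H) (sigma : R).
Hypothesis sigma_gt0 : 0 < sigma.

Lemma gaussian_sym (x y : X) : gaussian sigma x y = gaussian sigma y x.
Proof. by rewrite /gaussian distrC. Qed.

Lemma gaussian_diag (x : X) : gaussian sigma x x = 1.
Proof. by rewrite /gaussian subrr normr0 expr0n/= mulr0 expR0. Qed.

Variable y0 : X.

Let tau (x : X) : H := Num.sqrt (2 * sigma) *: (set_val x - set_val y0).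

(** Expand the squared norm of u - v with u = x - y0 and v = y - y0. The scaling of [tau] makes
    [dot (tau x) (tau y)] equal to the cross term [2 * sigma * dot u v]. *)
Lemma gaussianE x y : gaussian sigma x y =
  gaussian sigma x y0 * gaussian sigma y y0 * expR (dot (tau x) (tau y)).
Proof.
rewrite /gaussian -!expRD; congr expR.
have -> : set_val x - set_val y =
    set_val x - set_val y0 - (set_val y - set_val y0).
  by rewrite opprB addrA subrK.
rewrite /tau; set u := set_val x - _; set v := set_val y - _.
have -> : dot (Num.sqrt (2 * sigma) *: u) (Num.sqrt (2 * sigma) *: v) =
    2 * sigma * dot u v.
  rewrite linearZl_LR/= linearZr_LR/= mulrA -expr2 sqr_sqrtr//.
  by rewrite mulr_ge0 ?ltW.
by rewrite normB_sqr; ring.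
Qed.

(** Multiplying the coefficients by the weight and moving the points by [tau] turns the Gaussian
    energy into that of the exponential kernel, which is bounded below independently of the
    combination. *)
Lemma gaussian_wave_closure (c : nat -> R) (phi : R -> R) (a : H) :
  (forall n, c n ^+ 2 <= 1) ->
  (forall t, series (fun n => c n * (t ^+ n / n`!%:R)) @ \oo --> phi t) ->
  uniform_closure (range (kernel_comb (gaussian (X := X) sigma)))
    (fun x => gaussian sigma x y0 * phi (dot (tau x) a)).
Proof.
move=> c1 cphi.
apply: (@uniform_closure_kernel_comb _ _ _ _ (expR (dot a a))) => [x y|x|s].
- exact: gaussian_sym.
- exact: gaussian_diag.
have := exp_dot_form_bound dot a
  [seq (p.1 * gaussian sigma p.2 y0, tau p.2) | p <- s] c1 cphi.
rewrite /kernel_form !big_map; congr (_ <= _ - 2 * _).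
  apply: eq_bigr => p _; rewrite big_map; apply: eq_bigr => q _ /=.
  by rewrite [in RHS]gaussianE; ring.
by apply: eq_bigr => p _ /=; rewrite mulrA.
Qed.

Lemma gaussian_trig_poly_closure f : trig_poly dot tau f ->
  uniform_closure (range (kernel_comb (gaussian (X := X) sigma)))
    (fun x => gaussian sigma x y0 * f x).
Proof.
pose S := range (kernel_comb (gaussian (X := X) sigma)).
have rangeD u v : S u -> S v -> S (fun x => u x + v x).
  move=> [s _ <-] [s' _ <-]; exists (s ++ s') => //.
  by apply/funext => x; rewrite /kernel_comb big_cat.
have rangeZ b u : S u -> S (fun x => b * u x).
  move=> [s _ <-]; exists [seq (b * p.1, p.2) | p <- s] => //.
  apply/funext => x; rewrite /kernel_comb big_map mulr_sumr.
  by apply: eq_bigr => p _ /=; rewrite mulrA.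
move=> tf; elim: tf => {f} [a b|b f _ IH|f g _ IHf _ IHg].
- have -> : (fun x => gaussian sigma x y0 * cos (dot (tau x) a + b)) =
      (fun x => cos b * (gaussian sigma x y0 * cos (dot (tau x) a)) +
                - sin b * (gaussian sigma x y0 * sin (dot (tau x) a))).
    by apply/funext => x; rewrite cosD; ring.
  apply: uniform_closureD => //; apply: uniform_closureZ => //.
  (* The Taylor coefficients of cosine, and below of sine, are 0 or a sign over n!, so
     [c n ^+ 2 <= 1]. *)
  + apply: (@gaussian_wave_closure (fun n => (~~ odd n)%:R * (-1) ^+ n./2)).
      move=> n; rewrite exprMn -exprM mulnC exprM sqrrN expr1n.
      by case: odd; rewrite ?expr0n ?expr1n ?mulr1 ?mul0r.
    move=> t; rewrite unlock [X in series X](_ : _ = cos_coeff t).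
      exact: is_cvg_series_cos_coeff.
    by apply/funext => n; rewrite /cos_coeff /= mulrA.
  + apply: (@gaussian_wave_closure (fun n => (odd n)%:R * (-1) ^+ n.-1./2)).
      move=> n; rewrite exprMn -exprM mulnC exprM sqrrN expr1n.
      by case: odd; rewrite ?expr0n ?expr1n ?mulr1 ?mul0r.
    move=> t; rewrite unlock [X in series X](_ : _ = sin_coeff t).
      exact: is_cvg_series_sin_coeff.
    by apply/funext => n; rewrite /sin_coeff /= mulrA.
- under [X in uniform_closure _ X]eq_fun do rewrite mulrCA.
  exact: uniform_closureZ.
- under [X in uniform_closure _ X]eq_fun do rewrite mulrDr.
  exact: uniform_closureD.
Qed.

Lemma gaussian_dense (g : X -> R) :
  vanishes_at_infinity (fun x => gaussian sigma x y0) ->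
  continuous g -> vanishes_at_infinity g ->
  uniform_closure (range (kernel_comb (gaussian (X := X) sigma))) g.
Proof.
move=> w_oo cg g_oo.
have cval (f : H -> R) :
    continuous f -> continuous (fun x : X => f (set_val x)).
  by move=> cf x; apply: continuous_comp; [exact: initial_continuous|exact: cf].
have csub : continuous (fun z : H => z - set_val y0).
  by move=> z; apply: cvgB; [exact: cvg_id|exact: cvg_cst].
have ctau : continuous (fun z : H => Num.sqrt (2 * sigma) *: (z - set_val y0)).
  by move=> z; apply: cvgZl_tmp; exact: csub.
have cnorm : continuous (fun z : H => `|z - set_val y0|).
  by move=> z; apply: cvg_norm; exact: csub.
have cdot a : continuous (fun x => dot (tau x) a).
  apply: (cval (fun z =>
    dot (Num.sqrt (2 * sigma) *: (z - set_val y0)) a)) => z.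
  exact: (continuous_comp (ctau z) (@continuous_dotl a _)).
have cw : continuous (fun x => gaussian sigma x y0).
  apply: (cval (fun z => expR (- sigma * `|z - set_val y0| ^+ 2))) => z.
  apply: continuous_comp; last exact: continuous_expR.
  apply: cvgM; first exact: cvg_cst.
  exact: (continuous_comp (cnorm z) (@exprn_continuous R 2 _)).
have tau_inj : injective tau.
  move=> x y /(scalerI _); rewrite sqrtr_eq0 -ltNge mulr_gt0// => /(_ isT).
  by move=> /addIr /val_inj.
have trig_cont f : trig_poly dot tau f -> continuous f.
  elim=> {f} [a b|b f _ IH|f h _ IHf _ IHh] x.
  - apply: continuous_comp; last exact: continuous_cos.
    exact: (cvgD (cdot a x) (cvg_cst _)).
  - exact: (cvgM (cvg_cst _) (IH x)).
  - exact: (cvgD (IHf x) (IHh x)).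
have w01 x : 0 < gaussian sigma x y0 <= 1.
  rewrite expR_gt0 -expR0 ler_expR mulNr oppr_le0.
  by rewrite mulr_ge0 ?(ltW sigma_gt0)// exprn_ge0.
have := weighted_stone_weierstrass (trig_poly_cst dot tau)
  (@trig_add _ _ dot _ tau) (@trig_poly_mul _ _ dot _ tau)
  (@trig_poly_bounded _ _ dot _ tau) trig_cont
  (trig_poly_interpolates dot tau_inj) cw w01 w_oo cg g_oo.
(* The weighted trigonometric polynomials lie only in the closure of the kernel combinations, hence
   a closure of a closure. *)
move=> wg; apply: uniform_closure_idem => e e0.
have [_ [p tp <-] gp] := wg e e0.
exists (fun x => gaussian sigma x y0 * p x) => //.
exact: gaussian_trig_poly_closure.
Qed.
End Gaussian.

(** * Complex-valued functions and reproducing kernel Hilbert spaces *)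

Section ComplexModulus.
Variable R : realType.
Implicit Types (x y z : R[i]).

Lemma Re_normK z : (complex.Re `|z|)%:C%C = `|z|.
Proof. by rewrite normc_def. Qed.

Lemma Re_normD x y :
  complex.Re `|x + y| <= complex.Re `|x| + complex.Re `|y|.
Proof. by rewrite -lecR rmorphD/= !Re_normK ler_normD. Qed.

Lemma Re_norm_real (r : R) : complex.Re `|r%:C%C| = `|r|.
Proof. by rewrite normc_def/= expr0n addr0 sqrtr_sqr. Qed.

Lemma norm_Re_le z : `|complex.Re z| <= complex.Re `|z|.
Proof.
rewrite normc_def/= -sqrtr_sqr ler_wsqrtr// lerDl; exact: sqr_ge0.
Qed.

Lemma norm_Im_le z : `|complex.Im z| <= complex.Re `|z|.
Proof.
rewrite normc_def/= -sqrtr_sqr ler_wsqrtr// lerDr; exact: sqr_ge0.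
Qed.

Lemma Re_norm_le z :
  complex.Re `|z| <= `|complex.Re z| + `|complex.Im z|.
Proof.
case: z => a b; have E : (a +i* b)%C = a%:C%C + (0 +i* b)%C by simpc.
rewrite {1}E; apply: le_trans (Re_normD _ _) _; rewrite Re_norm_real lerD2l.
by rewrite normc_def/= expr0n add0r sqrtr_sqr.
Qed.

(** Positive elements of [R[i]] are real, so real radii suffice. *)
Lemma continuous_complexP (T : topologicalType) (f : T -> R[i]) :
  continuous (f : T -> R[i]^o) <->
  forall (t : T) (e : R), 0 < e ->
    \forall s \near t, complex.Re `|f t - f s| < e.
Proof.
split=> [cf x e e0|cf x].
  have /cvgrPdist_lt/(_ e%:C%C) := cf x; rewrite ltcR => /(_ e0).
  by apply: filterS => y /=; rewrite -Re_normK ltcR.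
apply/cvgrPdist_lt => e e0.
have eE : (complex.Re e)%:C%C = e by rewrite RRe_real// gtr0_real.
have := cf x (complex.Re e); rewrite -ltcR eE => /(_ e0).
by apply: filterS => y; rewrite -ltcR Re_normK eE.
Qed.

End ComplexModulus.

Section C0Functions.
Variables (R : realType) (T : topologicalType).

Lemma C0_uniform_limit (f : T -> R[i]) :
  (forall e : R, 0 < e -> exists2 h, C0 R T h &
    forall x, complex.Re `|f x - h x| <= e) -> C0 R T f.
Proof.
move=> fh; split=> [|e e0].
  apply/continuous_complexP => x e e0.
  have e40 : 0 < e / 4 by rewrite divr_gt0.
  have [h [/continuous_complexP ch _] fhe] := fh _ e40.
  apply: filterS (ch x _ e40) => y hxy.
  have -> : f x - f y = (f x - h x) + ((h x - h y) - (f y - h y)) by ring.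
  apply: le_lt_trans (Re_normD _ _) _.
  have := Re_normD (h x - h y) (- (f y - h y)); rewrite normrN.
  have := fhe x; have := fhe y; lra.
have e20 : 0 < e / 2 by rewrite divr_gt0.
have [h [_ /(_ _ e20)[L cL hL]] fhe] := fh _ e20.
exists L => // x /hL hx; rewrite -(subrK (h x) (f x)).
apply: le_lt_trans (Re_normD _ _) _; have := fhe x; lra.
Qed.

(** Stated for a general [p] to treat real and imaginary parts together. *)
Lemma C0_part (p : R[i] -> R) (f : T -> R[i]) :
  (forall x y, p x - p y = p (x - y)) ->
  (forall z, `|p z| <= complex.Re `|z|) ->
  C0 R T f -> continuous (p \o f) /\ vanishes_at_infinity (p \o f).
Proof.
move=> pB ple [/continuous_complexP cf f0]; split=> [x|e e0].
  apply/cvgrPdist_lt => e e0; apply: filterS (cf x e e0) => y /=.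
  by rewrite pB; exact: le_lt_trans (ple _).
by have [L cL fL] := f0 e e0; exists L => // x /fL; exact: le_lt_trans (ple _).
Qed.

End C0Functions.

Section ReproducingKernel.
Variables (R : realType) (T : Type) (K : T -> T -> R[i]) (HK : rkhs K).

Lemma rkhs_section_dot x y :
  rkhs_dot HK (rkhs_section HK y) (rkhs_section HK x) = K x y.
Proof. by rewrite rkhs_reproducing rkhs_sectionE. Qed.

Lemma rkhs_eval_sum n (c : 'I_n -> R[i]) (y : 'I_n -> T) x :
  rkhs_eval HK (\sum_(i < n) c i *: rkhs_section HK (y i)) x =
  \sum_(i < n) c i * K x (y i).
Proof.
rewrite linear_sum fct_sumE; apply: eq_bigr => i _.
by rewrite linearZ/= -(rkhs_sectionE HK).
Qed.

Lemma rkhs_positive_definite : positive_definite K.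
Proof.
move=> n x c _.
(* The coefficients are conjugated because the second argument of the dot product conjugates them
   back. *)
pose f := \sum_(nu < n) (c nu)^* *: rkhs_section HK (x nu).
have -> : \sum_(mu < n) \sum_(nu < n) c mu * (c nu)^* * K (x mu) (x nu) =
    rkhs_dot HK f f.
  rewrite [in RHS]/f linear_sumr.
  apply: eq_bigr => mu _; rewrite linearZr_LR/= rkhs_reproducing rkhs_eval_sum.
  by rewrite conjCK mulr_sumr; apply: eq_bigr => nu _; rewrite mulrA.
by rewrite rkhs_norm exprn_ge0.
Qed.

(** The section at [x] is a unit vector, and [f] minus its projection onto it has squared norm |f|^2
    - |f(x)|^2. *)
Lemma rkhs_eval_le (f : HK) x : K x x = 1 -> `|rkhs_eval HK f x| <= `|f|.
Proof.
move=> K1; rewrite -rkhs_reproducing; set s := rkhs_section HK x.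
have ss : rkhs_dot HK s s = 1 by rewrite rkhs_section_dot.
set a := rkhs_dot HK f s.
have : 0 <= rkhs_dot HK (f - a *: s) (f - a *: s).
  by rewrite rkhs_norm exprn_ge0.
rewrite linearBl/= !linearBr/= !linearZl_LR/= !linearZr_LR/= ss.
have -> : rkhs_dot HK s f = a^* by rewrite hermC expr0 mul1r.
rewrite -/a mulr1 rkhs_norm => h.
rewrite -(@ler_pXn2r _ 2) ?nnegrE// normCK -subr_ge0.
by move: h; congr (0 <= _); rewrite /GRing.scale/=; ring.
Qed.

End ReproducingKernel.

(** * Universality of the Gaussian kernel *)

Section GaussianUniversality.
Variables (R : realType) (H : normedModType R) (X : set H) (sigma : R).

Lemma gaussian_kernel_diag (x : X) : gaussian_kernel X sigma x x = 1.
Proof. by rewrite /gaussian_kernel gaussian_diag. Qed.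

(* The norm of the space dominates the supremum norm, so that only the finite
   combinations of the kernel sections matter. *)
Lemma rkhs_functions_sub_C0 (HG HK : rkhs (gaussian_kernel X sigma)) :
  rkhs_functions HK `<=` C0 R X -> rkhs_functions HG `<=` C0 R X.
Proof.
move=> KC0 _ [f _ <-]; apply: C0_uniform_limit => e e0.
have ballO : open (ball f e%:C%C) by apply: ball_open; rewrite ltcR.
have [|u [fu [n [c [y uE]]]]] := @rkhs_dense _ _ _ HG _ _ ballO.
  by exists f; apply: ballxx; rewrite ltcR.
exists (rkhs_eval HG u).
  (* The same combination formed in [HK] evaluates to the same function, since both families of
     sections evaluate to the kernel. *)
  apply: KC0; exists (\sum_(i < n) c i *: rkhs_section HK (y i)) => //.
  by apply/funext => x; rewrite uE !rkhs_eval_sum.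
move=> x; rewrite -lecR Re_normK.
have -> : rkhs_eval HG f x - rkhs_eval HG u x = rkhs_eval HG (f - u) x.
  by rewrite linearB.
apply: le_trans (rkhs_eval_le _ (gaussian_kernel_diag x)) _.
by move: fu; rewrite -ball_normE /= => /ltW.
Qed.

Lemma rkhs_eval_kernel_comb (HG : rkhs (gaussian_kernel X sigma))
    (s : seq (R * X)) :
  rkhs_eval HG (\sum_(p <- s) p.1%:C%C *: rkhs_section HG p.2) =
  fun x => (kernel_comb (gaussian sigma) s x)%:C%C.
Proof.
apply/funext => x; rewrite linear_sum fct_sumE /kernel_comb rmorph_sum.
apply: eq_bigr => p _; rewrite linearZ/= rmorphM/=.
by rewrite -[X in _ = _ * X](rkhs_sectionE HG).
Qed.

End GaussianUniversality.

(* The topology of the type X is the one induced by H; local compactness is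
   that of the space X, not of X seen inside H. *)
Theorem theorem3p4 (R : realType) (H : completeNormedModType R)
    (dot : {dot H for idfun}) (dot_norm : norm_of_dot dot)
    (X : set H) (X_locally_compact : locally_compact [set: X])
    (sigma : R) (sigma_gt0 : 0 < sigma)
    (HG : rkhs (gaussian_kernel X sigma)) :
  C0_universal (gaussian_kernel X sigma) <->
  rkhs_functions HG `<=` C0 R X.
Proof.
split=> [[_ [HK [KC0 _]]]|GC0]; first exact: rkhs_functions_sub_C0 KC0.
split; first exact: rkhs_positive_definite HG.
exists HG; split=> // g eps gC0 eps0.
(* The argument needs a base point. Over an empty [X] the supremum runs over the empty set, and the
   zero function serves. *)
have [[y0 _]|X0] := pselect ([set: X] !=set0); last first.
  exists (rkhs_eval HG 0); first by exists 0.
  apply: (@le_lt_trans _ _ 0%:E); last by rewrite lte_fin.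
  by apply: ub_ereal_sup => _ [x _ <-]; case: X0; exists x.
(* The real and imaginary parts cost [eps / 4] each; the total [eps / 2] leaves room for the strict
   inequality. *)
have e0 : 0 < eps / 4 by rewrite divr_gt0.
have ReB (x y : R[i]) : complex.Re x - complex.Re y = complex.Re (x - y).
  by case: x; case: y.
have ImB (x y : R[i]) : complex.Im x - complex.Im y = complex.Im (x - y).
  by case: x; case: y.
have [cRe Re0] := C0_part ReB (@norm_Re_le R) gC0.
have [cIm Im0] := C0_part ImB (@norm_Im_le R) gC0.
(* The weight is the kernel section at [y0], so the inclusion in C_0(X) applies to it. *)
have w_oo : vanishes_at_infinity (fun x : X => gaussian sigma x y0).
  have [|_ w0] :=
    C0_part ReB (@norm_Re_le R) (f := gaussian_kernel X sigma ^~ y0).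
    apply: GC0; exists (rkhs_section HG y0) => //.
    by apply/funext => x; rewrite rkhs_sectionE.
  exact: w0.
have [_ [s1 _ <-] gs1] :=
  gaussian_dense dot_norm sigma_gt0 w_oo cRe Re0 e0.
have [_ [s2 _ <-] gs2] :=
  gaussian_dense dot_norm sigma_gt0 w_oo cIm Im0 e0.
pose f := \sum_(p <- s1) p.1%:C%C *: rkhs_section HG p.2 +
  'i%C *: \sum_(p <- s2) p.1%:C%C *: rkhs_section HG p.2.
exists (rkhs_eval HG f); first by exists f.
have fE x : rkhs_eval HG f x = (kernel_comb (gaussian sigma) s1 x
    +i* kernel_comb (gaussian sigma) s2 x)%C.
  rewrite /f linearD linearZ/= !rkhs_eval_kernel_comb.
  by rewrite [LHS]/GRing.add /GRing.scale /=; simpc.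
apply: (@le_lt_trans _ _ (eps / 2)%:E).
  apply: ub_ereal_sup => _ [x _ <-]; rewrite lee_fin.
  apply: le_trans (Re_norm_le _) _; rewrite -ReB -ImB fE/=.
  have := gs1 x; have := gs2 x.
  by rewrite /= ![`|_ - kernel_comb _ _ _|]distrC; lra.
by rewrite lte_fin; lra.
Qed.
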